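(* There is a Quillen model structure on $\mathrm{ZSet}$ with (a) the Acyclic ZSet maps as the weak equivalences $\mathcal{W}$, (b) all ZSet maps as the fibrations $\mathcal{F}$, (c) cofibrations $\mathcal{C}={}^\dagger\underline{\mathcal{F}}={}^\dagger\mathcal{W}$, where $\underline{\mathcal{F}}=\mathcal{W}\cap\mathcal{F}$.
   Context: A Z-set is a pair $(S,\sigma)$ with $S$ a set and $\sigma:S\to S$ a bijection; a map of Z-sets is a function commuting with the $\sigma$'s; this is the category $\mathrm{ZSet}$. A map $f:(S,\sigma)\to(T,\sigma)$ is Acyclic when $C_n(f):C_n(S,\sigma)\to C_n(T,\sigma)$ is a bijection for every $n>0$, where $C_n(S,\sigma)=\{x\in S:\sigma^n(x)=x\}$. $\ell\dagger r$ means every commutative square with left side $\ell$ and right side $r$ has a diagonal filler; $\mathcal{F}^\dagger=\{r:f\dagger r\ \forall f\in\mathcal{F}\}$, ${}^\dagger\mathcal{F}=\{\ell:\ell\dagger f\ \forall f\in\mathcal{F}\}$. A weak factorization system is a pair $(\mathcal{L},\mathcal{R})$ with $\mathcal{L}^\dagger=\mathcal{R}$, $\mathcal{L}={}^\dagger\mathcal{R}$, such that every morphism factors as $r\circ\ell$ with $\ell\in\mathcal{L}$, $r\in\mathcal{R}$. A model structure on a category with finite limits and colimits is a triple $(\mathcal{C},\mathcal{W},\mathcal{F})$ of classes of morphisms (cofibrations, weak equivalences, fibrations) such that (1) if two of $a,b,a\circ b$ are in $\mathcal{W}$ so is the third; (2) $(\mathcal{C}\cap\mathcal{W},\mathcal{F})$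 is a weak factorization system; (3) $(\mathcal{C},\mathcal{W}\cap\mathcal{F})$ is a weak factorization system. *)

(* Defs.v *)
From mathcomp Require Import all_boot.
From mathcomp Require Import boolp classical_sets cardinality.

Set Implicit Arguments.
Unset Strict Implicit.
Unset Printing Implicit Defensive.

Local Open Scope classical_set_scope.

Record category : Type := Category {
  obj :> Type;
  hom : obj -> obj -> Type;
  idm : forall X, hom X X;
  comp : forall X Y Z, hom Y Z -> hom X Y -> hom X Z;
  comp_idl : forall X Y (f : hom X Y), comp (idm Y) f = f;
  comp_idr : forall X Y (f : hom X Y), comp f (idm X) = f;
  comp_assoc : forall X Y Z T (f : hom X Y) (g : hom Y Z) (h : hom Z T),
    comp h (comp g f) = comp (comp h g) f }.

Arguments hom {c} X Y.
Arguments idm {c} X.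
Arguments comp {c X Y Z} g f.

Declare Scope cat_scope.
Delimit Scope cat_scope with cat.
Notation "g \c f" := (comp g f)
  (at level 40, left associativity) : cat_scope.
Local Open Scope cat_scope.

Record functor (J D : category) : Type := Functor {
  fobj :> J -> D;
  fmap : forall i j : J, hom i j -> hom (fobj i) (fobj j);
  fmap_id : forall i : J, fmap (idm i) = idm (fobj i);
  fmap_comp : forall (i j k : J) (u : hom i j) (v : hom j k),
    fmap (v \c u) = fmap v \c fmap u }.

Arguments fmap {J D} f {i j} u.

Section Limits.
Variables (J D : category) (F : functor J D).

Definition is_cone (L : D) (p : forall i : J, hom L (F i)) : Prop :=
  forall (i j : J) (u : hom i j), fmap F u \c p i = p j.

Definition is_limit (L : D) (p : forall i : J, hom L (F i)) : Prop :=
  is_cone p /\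
  forall (A : D) (q : forall i : J, hom A (F i)), is_cone q ->
    exists! h : hom A L, forall i : J, p i \c h = q i.

Definition is_cocone (L : D) (p : forall i : J, hom (F i) L) : Prop :=
  forall (i j : J) (u : hom i j), p j \c fmap F u = p i.

Definition is_colimit (L : D) (p : forall i : J, hom (F i) L) : Prop :=
  is_cocone p /\
  forall (A : D) (q : forall i : J, hom (F i) A), is_cocone q ->
    exists! h : hom L A, forall i : J, h \c p i = q i.

End Limits.

Definition finite_category (J : category) : Prop :=
  finite_set [set: J] /\ forall i j : J, finite_set [set: hom i j].

(* Objects of J live in a universe above that of the carriers of Z-sets, so a
   product over J has to be rebuilt over a small index type. *)
Definition has_finite_limits (D : category) : Prop :=
  forall J : category, finite_category J -> forall F : functor J D,
    exists (L : D) (p : forall i : J, hom L (F i)), is_limit p.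

Definition has_finite_colimits (D : category) : Prop :=
  forall J : category, finite_category J -> forall F : functor J D,
    exists (L : D) (p : forall i : J, hom (F i) L), is_colimit p.

Definition mor_class (D : category) : Type :=
  forall X Y : D, hom X Y -> Prop.

Definition mor_all (D : category) : mor_class D := fun _ _ _ => True.

Arguments mor_all {D} X Y f.

Definition mor_cap (D : category) (P Q : mor_class D) : mor_class D :=
  fun X Y f => P X Y f /\ Q X Y f.

Section Lifting.
Variable D : category.

Definition lifts (A B X Y : D) (l : hom A B) (r : hom X Y) : Prop :=
  forall (u : hom A X) (v : hom B Y), r \c u = v \c l ->
    exists h : hom B X, h \c l = u /\ r \c h = v.

Definition rlp (P : mor_class D) : mor_class D :=
  fun X Y r => forall (A B : D) (f : hom A B), P A B f -> lifts f r.

Definition llp (P : mor_class D) : mor_class D :=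
  fun A B l => forall (X Y : D) (f : hom X Y), P X Y f -> lifts l f.

Record weak_factorization_system (L R : mor_class D) : Prop := {
  wfs_rlp : rlp L = R;
  wfs_llp : L = llp R;
  wfs_factor : forall (X Y : D) (f : hom X Y),
    exists (Z : D) (l : hom X Z) (r : hom Z Y),
      L X Z l /\ R Z Y r /\ f = r \c l }.

Definition two_of_three (W : mor_class D) : Prop :=
  forall (X Y Z : D) (b : hom X Y) (a : hom Y Z),
    (W Y Z a -> W X Y b -> W X Z (a \c b)) /\
    (W Y Z a -> W X Z (a \c b) -> W X Y b) /\
    (W X Y b -> W X Z (a \c b) -> W Y Z a).

End Lifting.

(* Model structures are only considered on finitely complete and cocomplete
   categories, so this is part of the structure. *)
Record model_structure (D : category) : Type := ModelStructure {
  cofibration : mor_class D;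
  weak_equivalence : mor_class D;
  fibration : mor_class D;
  model_finite_limits : has_finite_limits D;
  model_finite_colimits : has_finite_colimits D;
  model_two_of_three : two_of_three weak_equivalence;
  model_acyclic_cofibration : weak_factorization_system
    (mor_cap cofibration weak_equivalence) fibration;
  model_acyclic_fibration : weak_factorization_system
    cofibration (mor_cap weak_equivalence fibration) }.

Record zset : Type := ZSetObj {
  zcar :> Type;
  sigma : zcar -> zcar;
  sigma_bij : bijective sigma }.

Arguments sigma {z} x.

Record zmap (S T : zset) : Type := ZMap {
  zfun :> S -> T;
  zfun_sigma : forall x : S, zfun (sigma x) = sigma (zfun x) }.

Lemma zmap_ext (S T : zset) (f g : zmap S T) : f =1 g -> f = g.
Proof.
case: f g => f hf [g hg] /= /funext fg; case: _ / fg hg => hg.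
by rewrite (Prop_irrelevance hf hg).
Qed.

Definition zid (S : zset) : zmap S S := @ZMap S S id (fun=> erefl).

Lemma zcomp_sigma (S T U : zset) (g : zmap T U) (f : zmap S T) (x : S) :
  (g \o f) (sigma x) = sigma ((g \o f) x).
Proof. by rewrite /= !zfun_sigma. Qed.

Definition zcomp (S T U : zset) (g : zmap T U) (f : zmap S T) : zmap S U :=
  ZMap (zcomp_sigma g f).

Lemma zcomp_idl (S T : zset) (f : zmap S T) : zcomp (zid T) f = f.
Proof. exact: zmap_ext. Qed.

Lemma zcomp_idr (S T : zset) (f : zmap S T) : zcomp f (zid S) = f.
Proof. exact: zmap_ext. Qed.

Lemma zcomp_assoc (S T U V : zset)
    (f : zmap S T) (g : zmap T U) (h : zmap U V) :
  zcomp h (zcomp g f) = zcomp (zcomp h g) f.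
Proof. exact: zmap_ext. Qed.

Definition ZSet : category := Category zcomp_idl zcomp_idr zcomp_assoc.

(* The set written C_n(S, sigma). *)
Definition cyc (n : nat) (S : zset) : Type := {x : S | iter n sigma x = x}.

Lemma zfun_iter (S T : zset) (f : zmap S T) (n : nat) (x : S) :
  iter n sigma x = x -> iter n sigma (f x) = f x.
Proof.
by move=> {2}<-; elim: n => //= n ->; rewrite zfun_sigma.
Qed.

Definition cyc_map (n : nat) (S T : zset) (f : zmap S T) (x : cyc n S) :
  cyc n T := exist _ (f (sval x)) (zfun_iter f (svalP x)).

Definition acyclic : mor_class ZSet :=
  fun (S T : zset) (f : zmap S T) =>
    forall n : nat, (0 < n)%N -> bijective (@cyc_map n S T f).

(* Main.v *)
(** A map lifting against itself is invertible, so the acyclic cofibrations are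
    the isomorphisms and the first factorization system is (isomorphisms, all
    maps).  For the second one, [f : X -> Y] factors through the Z-set made of
    the non-periodic points of [X] and the periodic points of [Y]: the second
    factor is bijective on periodic points, and a lift of the first factor
    against an acyclic map is forced on the periodic points of [Y] and given on
    the non-periodic points of [X].  If [f] has the right lifting property
    against the first factor, it is a retract of the second one, hence
    acyclic. *)

Require Import Defs.
From mathcomp Require Import all_boot.
From mathcomp Require Import boolp classical_sets cardinality.

Set Implicit Arguments.
Unset Strict Implicit.
Unset Printing Implicit Defensive.

Local Open Scope classical_set_scope.
Local Open Scope cat_scope.

(** * Lifting properties and isomorphisms in an arbitrary category *)

Lemma mor_class_ext (D : category) (P Q : mor_class D) :
  (forall X Y f, P X Y f <-> Q X Y f) -> P = Q.
Proof.
move=> PQ; apply: functional_extensionality_dep => X.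
apply: functional_extensionality_dep => Y.
by apply/funext => f; apply/propext.
Qed.

Lemma mor_cap_allr (D : category) (P : mor_class D) : mor_cap P mor_all = P.
Proof. by apply: mor_class_ext => X Y f; split=> [[]|]. Qed.

Definition isomorphism (D : category) : mor_class D :=
  fun X Y f => exists g : hom Y X, g \c f = idm X /\ f \c g = idm Y.

Arguments isomorphism {D} X Y f.

(** A filler of the square with identities as horizontal sides is a two-sided inverse. *)
Lemma lifts_self_iso (D : category) (X Y : D) (f : hom X Y) :
  lifts f f -> isomorphism X Y f.
Proof.
by move=> /(_ (idm X) (idm Y)) []; [rewrite comp_idl comp_idr | move=> g; exists g].
Qed.

Lemma iso_lifts (D : category) (A B X Y : D) (l : hom A B) (r : hom X Y) :
  isomorphism A B l -> lifts l r.
Proof.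
move=> [g [gl lg]] u v E; exists (u \c g); split.
  by rewrite -comp_assoc gl comp_idr.
by rewrite comp_assoc E -comp_assoc lg comp_idr.
Qed.

Lemma isomorphism_all_wfs (D : category) :
  weak_factorization_system (@isomorphism D) mor_all.
Proof.
split.
- by apply: mor_class_ext => X Y r; split=> // _ A B l; apply: iso_lifts.
- apply: mor_class_ext => X Y l; split=> [il A B r _|]; first exact: iso_lifts.
  by move=> /(_ X Y l I) /lifts_self_iso.
- move=> X Y f; exists X, (idm X), f; split; last by rewrite comp_idr.
  by exists (idm X); rewrite comp_idl.
Qed.

(** * Constructions on Z-sets: subobjects, products, sums, quotients *)

(** [bijective] lives in [Prop] and does not eliminate into [Type], so an inverse is chosen by [cid]
    after repackaging as an existential. *)
Definition sigma_inv (S : zset) : S -> S :=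
  let: exist g _ := cid (let: Bijective g gK Kg := sigma_bij S in
    ex_intro (fun g => cancel sigma g /\ cancel g sigma) g (conj gK Kg)) in g.

Lemma sigmaK (S : zset) : cancel (@sigma S) (@sigma_inv S).
Proof. by rewrite /sigma_inv; case: cid => g []. Qed.

Lemma sigma_invK (S : zset) : cancel (@sigma_inv S) (@sigma S).
Proof. by rewrite /sigma_inv; case: cid => g []. Qed.

Lemma sigma_inj (S : zset) : injective (@sigma S).
Proof. exact: can_inj (@sigmaK S). Qed.

Lemma zmap_eqfun (S T : zset) (f g : zmap S T) : f = g -> f =1 g.
Proof. by move=> ->. Qed.

Lemma sval_inj (T : Type) (P : T -> Prop) (x y : {x : T | P x}) :
  sval x = sval y -> x = y.
Proof. by case: x y => x Px [y Py] /=; apply: eq_exist. Qed.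

Section Subobject.
Variables (S : zset) (P : S -> Prop).
Hypothesis P_sigma : forall x, P (sigma x) <-> P x.

Definition zsub_sigma (x : {x : S | P x}) : {x : S | P x} :=
  exist _ (sigma (sval x)) ((P_sigma _).2 (svalP x)).

Lemma zsub_sigma_bij : bijective zsub_sigma.
Proof.
have PV x : P x -> P (sigma_inv x) by rewrite -{1}[x]sigma_invK P_sigma.
exists (fun x => exist _ (sigma_inv (sval x)) (PV _ (svalP x))) => x;
  apply: sval_inj => /=; [exact: sigmaK | exact: sigma_invK].
Qed.

Definition zsub : zset := ZSetObj zsub_sigma_bij.

Definition zsub_incl : zmap zsub S := @ZMap zsub S (@sval _ _) (fun=> erefl).

Definition zsub_lift (A : zset) (f : zmap A S) (Pf : forall x, P (f x)) :
  zmap A zsub.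
Proof.
apply: (@ZMap A zsub (fun x => exist _ (f x) (Pf x))) => x.
by apply: sval_inj; rewrite /= zfun_sigma.
Defined.

End Subobject.

Lemma iter_zsub_sigma (S : zset) (P : S -> Prop)
    (P_sigma : forall x, P (sigma x) <-> P x) (n : nat) (x : zsub P_sigma) :
  sval (iter n sigma x) = iter n sigma (sval x).
Proof. by elim: n => //= n ->. Qed.

Section IndexedProductSum.
Variables (I : Type) (F : I -> zset).

Lemma zprod_sigma_bij :
  bijective (fun (x : forall i, F i) i => sigma (x i)).
Proof.
exists (fun x i => sigma_inv (x i)) => x; apply: functional_extensionality_dep => i;
  [exact: sigmaK | exact: sigma_invK].
Qed.

Definition zprod : zset := ZSetObj zprod_sigma_bij.

Definition zprod_proj (i : I) : zmap zprod (F i) :=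
  @ZMap zprod (F i) (fun x => x i) (fun=> erefl).

Definition zprod_pair (A : zset) (f : forall i, zmap A (F i)) : zmap A zprod.
Proof.
apply: (@ZMap A zprod (fun a i => f i a)) => a.
by apply: functional_extensionality_dep => i; rewrite zfun_sigma.
Defined.

Definition zcoprod_sigma (x : {i : I & F i}) : {i : I & F i} :=
  existT (fun i => F i : Type) (tag x) (sigma (tagged x)).

Lemma zcoprod_sigma_bij : bijective zcoprod_sigma.
Proof.
exists (fun x => existT (fun i => F i : Type) (tag x) (sigma_inv (tagged x)));
  by case=> i x; rewrite /zcoprod_sigma /= ?sigmaK ?sigma_invK.
Qed.

Definition zcoprod : zset := ZSetObj zcoprod_sigma_bij.

Definition zcoprod_inj (i : I) : zmap (F i) zcoprod :=
  @ZMap (F i) zcoprod (fun x => existT (fun i => F i : Type) i x) (fun=> erefl).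

Definition zcoprod_case (A : zset) (f : forall i, zmap (F i) A) : zmap zcoprod A.
Proof.
apply: (@ZMap zcoprod A (fun x => f (tag x) (tagged x))) => x.
exact: zfun_sigma.
Defined.

End IndexedProductSum.

Section BinarySum.
Variables S T : zset.

Definition zsum_sigma (x : S + T) : S + T :=
  match x with inl s => inl (sigma s) | inr t => inr (sigma t) end.

Lemma zsum_sigma_bij : bijective zsum_sigma.
Proof.
exists (fun x => match x with
  | inl s => inl (sigma_inv s) | inr t => inr (sigma_inv t) end);
  by case=> x /=; rewrite ?sigmaK ?sigma_invK.
Qed.

Definition zsum : zset := ZSetObj zsum_sigma_bij.

Definition zsum_inr : zmap T zsum := @ZMap T zsum inr (fun=> erefl).

Definition zsum_case (A : zset) (f : zmap S A) (g : zmap T A) : zmap zsum A.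
Proof.
apply: (@ZMap zsum A (fun x => match x with inl s => f s | inr t => g t end)).
by case=> x; apply: zfun_sigma.
Defined.

End BinarySum.

Lemma iter_zsum_inl (S T : zset) (n : nat) (x : S) :
  iter n sigma (inl x : zsum S T) = inl (iter n sigma x).
Proof. by elim: n => //= n ->. Qed.

Lemma iter_zsum_inr (S T : zset) (n : nat) (y : T) :
  iter n sigma (inr y : zsum S T) = inr (iter n sigma y).
Proof. by elim: n => //= n ->. Qed.

Section Quotient.
Variables (S : zset) (R : S -> S -> Prop).
Hypothesis R_refl : forall x, R x x.
Hypothesis R_sym : forall x y, R x y -> R y x.
Hypothesis R_trans : forall x y z, R x y -> R y z -> R x z.
Hypothesis R_sigma : forall x y, R (sigma x) (sigma y) <-> R x y.

(** A class is stored as the predicate [R x], so that extensionality of predicates turns related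
    points into equal classes. *)
Definition zquot_car : Type := {P : S -> Prop | exists x, P = R x}.

Definition zquot_class (x : S) : zquot_car :=
  exist _ (R x) (ex_intro _ x erefl).

Definition zquot_repr (q : zquot_car) : S := sval (cid (svalP q)).

Lemma zquot_reprK : cancel zquot_repr zquot_class.
Proof.
by move=> q; apply: sval_inj; rewrite /zquot_repr; case: cid.
Qed.

Lemma zquot_classP (x y : S) : zquot_class x = zquot_class y <-> R x y.
Proof.
split=> [/(congr1 (@sval _ _)) /= ->//|Rxy]; apply: sval_inj => /=.
apply/funext => z; apply/propext; split; last exact: R_trans.
exact/R_trans/R_sym.
Qed.

Lemma zquot_repr_class (x : S) : R (zquot_repr (zquot_class x)) x.
Proof. by apply/zquot_classP; rewrite zquot_reprK. Qed.

Definition zquot_sigma (q : zquot_car) : zquot_car :=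
  zquot_class (sigma (zquot_repr q)).

Lemma zquot_class_sigma (x : S) :
  zquot_class (sigma x) = zquot_sigma (zquot_class x).
Proof. by apply/zquot_classP/R_sigma/R_sym/zquot_repr_class. Qed.

Lemma zquot_sigma_bij : bijective zquot_sigma.
Proof.
exists (fun q => zquot_class (sigma_inv (zquot_repr q))) => q.
  rewrite -[RHS]zquot_reprK; apply/zquot_classP/R_sigma.
  by rewrite sigma_invK; apply: zquot_repr_class.
by rewrite -zquot_class_sigma sigma_invK zquot_reprK.
Qed.

Definition zquot : zset := ZSetObj zquot_sigma_bij.

Definition zquot_proj : zmap S zquot :=
  @ZMap S zquot zquot_class zquot_class_sigma.

Definition zquot_lift (A : zset) (f : zmap S A)
  (Rf : forall x y, R x y -> f x = f y) : zmap zquot A.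
Proof.
apply: (@ZMap zquot A (f \o zquot_repr)) => q.
by rewrite /= -zfun_sigma; apply/Rf/zquot_repr_class.
Defined.

Lemma zquot_lift_class (A : zset) (f : zmap S A)
    (Rf : forall x y, R x y -> f x = f y) (x : S) :
  zquot_lift Rf (zquot_class x) = f x.
Proof. exact/Rf/zquot_repr_class. Qed.

End Quotient.

(** * Finite limits and colimits of Z-sets *)

(* [I : Set] because ['I_n] lives in a universe too large to index a product of
   Z-sets.  The comparison maps [u] and [v] stand for an equality [e k = i], and
   spare transports along it. *)
Lemma finite_category_small (J : category) : finite_category J ->
  exists (I : Set) (e : I -> J), forall i : J,
    exists (k : I) (u : hom (e k) i) (v : hom i (e k)), u \c v = idm i.
Proof.
move=> [fJ _].
have /finite_seqP[s sE] : finite_set [set: {classic J}] by [].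
pose e (k : {k : nat | k < size s}) : J :=
  tnth (in_tuple s) (Ordinal (svalP k)).
exists {k : nat | k < size s}, e => i.
have /(@tnthP _ _ (in_tuple s))[[k ks] ik] : (i : {classic J}) \in s.
  by have : [set: {classic J}] i by []; rewrite sE.
exists (exist _ k ks); have -> : i = e (exist _ k ks).
  by rewrite ik /e; congr tnth; apply: val_inj.
by exists (idm _), (idm _); apply: comp_idl.
Qed.

Lemma ZSet_finite_limits : has_finite_limits ZSet.
Proof.
move=> J /finite_category_small[I [e /choice[k /= ekP]]] F.
have {}ekP i : {w : hom (e (k i)) i * hom i (e (k i)) | w.1 \c w.2 = idm i}.
  by apply: cid; have [u [v uv]] := ekP i; exists (u, v).
pose u i := (sval (ekP i)).1; pose v i := (sval (ekP i)).2.
have uv i : u i \c v i = idm i := svalP (ekP i).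
pose Fe : I -> zset := fun a => F (e a).
(* The limit is the Z-set of compatible families, indexed by [I] only. *)
pose P (x : zprod Fe) :=
  forall a b (w : hom (e a) (e b)), fmap F w (x a) = x b.
have Psigma x : P (sigma x) <-> P x.
  split=> Px a b w; last by rewrite /= zfun_sigma Px.
  by apply: sigma_inj; rewrite -zfun_sigma Px.
(* An object [i] is only known as a retract of [e (k i)]: the cone reads the component at [k i] and
   carries it along [u i]. *)
pose p i : zmap (zsub Psigma) (F i) :=
  zcomp (fmap F (u i)) (zcomp (zprod_proj Fe (k i)) (zsub_incl Psigma)).
exists (zsub Psigma), p; split=> [i j w|A q q_cone].
  apply: zmap_ext => -[x Px] /=.
  (* [v j \c w \c u i] runs between objects in the image of [e], so compatibility of [x] applies to
     it; [u j \c v j = idm j] then removes the detour. *)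
  have -> : x (k j) = fmap F (v j \c w \c u i) (x (k i)) by rewrite Px.
  have E (y : F (e (k i))) : fmap F w (fmap F (u i) y) =
      fmap F (u j) (fmap F (v j \c w \c u i) y).
    have /zmap_eqfun/(_ y) : fmap F (w \c u i) =
      fmap F (u j \c (v j \c w \c u i)) by rewrite !comp_assoc uv comp_idl.
    by rewrite !fmap_comp.
  exact: E.
have Pq x : P (zprod_pair (fun a => q (e a) : zmap A (Fe a)) x).
  by move=> a b w; apply: (zmap_eqfun (q_cone _ _ w) x).
exists (zsub_lift Psigma Pq); split=> [i|h hP].
  by apply: zmap_ext => x; apply: (zmap_eqfun (q_cone _ _ (u i)) x).
apply: zmap_ext => x; apply: sval_inj; apply: functional_extensionality_dep => a /=.
(* The component at [a] is recovered from the one at [k (e a)] by compatibility along [u (e a)], so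
   the cone determines it. *)
rewrite -(zmap_eqfun (hP (e a)) x) /=.
exact: svalP (h x) _ _ _.
Qed.

Lemma ZSet_finite_colimits : has_finite_colimits ZSet.
Proof.
move=> J /finite_category_small[I [e /choice[k /= ekP]]] F.
have {}ekP i : {w : hom (e (k i)) i * hom i (e (k i)) | w.1 \c w.2 = idm i}.
  by apply: cid; have [u [v uv]] := ekP i; exists (u, v).
pose v i := (sval (ekP i)).2.
have [u uv] : exists u : forall i, hom (e (k i)) i, forall i, u i \c v i = idm i.
  by exists (fun i => (sval (ekP i)).1) => i; exact: svalP (ekP i).
pose Fe : I -> zset := fun a => F (e a).
pose S := zcoprod Fe.
pose desc (A : zset) (q : forall i, zmap (F i) A) : zmap S A :=
  zcoprod_case (fun a => q (e a) : zmap (Fe a) A).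
(* Points are identified when no cocone separates them; as [Prop] is
   impredicative this avoids generating an equivalence relation. *)
pose R (x y : S) := forall (A : ZSet) (q : forall i, hom (F i) A),
  is_cocone q -> desc A q x = desc A q y.
have R_refl x : R x x by [].
have R_sym x y : R x y -> R y x by move=> Rxy A q /Rxy.
have R_trans x y z : R x y -> R y z -> R x z.
  by move=> Rxy Ryz A q q_cocone; rewrite Rxy ?Ryz.
have R_sigma x y : R (sigma x) (sigma y) <-> R x y.
  split=> Rxy A q q_cocone; last by rewrite !zfun_sigma Rxy.
  by apply: sigma_inj; rewrite -!zfun_sigma Rxy.
pose Q := zquot R_refl R_sym R_trans R_sigma.
pose pi : zmap S Q := zquot_proj R_refl R_sym R_trans R_sigma.
have piP x y : R x y -> pi x = pi y by move/(zquot_classP R_refl R_sym R_trans).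
pose p i : zmap (F i) Q :=
  zcomp pi (zcomp (zcoprod_inj Fe (k i)) (fmap F (v i))).
exists Q, p; split=> [i j w|A q q_cocone].
  (* Evaluated by a test cocone [q], the two sides become [q j (fmap F w x)] and [q i x]. *)
  apply: zmap_ext => x; apply: piP => A q q_cocone /=.
  rewrite [LHS](zmap_eqfun (q_cocone _ _ (v j))).
  rewrite [RHS](zmap_eqfun (q_cocone _ _ (v i))).
  exact: (zmap_eqfun (q_cocone _ _ w) x).
have Rq x y : R x y -> desc A q x = desc A q y by apply.
exists (zquot_lift R_refl R_sym R_trans R_sigma Rq); split=> [i|h hP].
  apply: zmap_ext => x /=.
  rewrite [LHS](zquot_lift_class R_refl R_sym R_trans R_sigma Rq).
  exact: (zmap_eqfun (q_cocone _ _ (v i)) x).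
apply: zmap_ext => z; rewrite -[z](zquot_reprK (R := R)).
move: (zquot_repr z) => -[a x].
rewrite (zquot_lift_class R_refl R_sym R_trans R_sigma Rq) /=.
(* The class of [x] in summand [a] equals [p (e a) x], since no cocone separates their
   representatives; hence [h] is determined there. *)
rewrite -(zmap_eqfun (hP (e a)) x) /=; congr (h _); apply: piP => B r r_cocone /=.
exact: (zmap_eqfun (r_cocone _ _ (v (e a))) x).
Qed.

(** * Acyclic maps and periodic points *)

(** Removes the dependent pairs of [cyc], so that later arguments handle points of [S] and [T]
    directly. In the converse, preimages are chosen by [cid]. *)
Lemma acyclicP (S T : zset) (f : zmap S T) :
  acyclic f <-> forall n, 0 < n ->
    (forall y : T, iter n sigma y = y ->
       exists2 x : S, iter n sigma x = x & f x = y) /\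
    (forall x x' : S, iter n sigma x = x -> iter n sigma x' = x' ->
       f x = f x' -> x = x').
Proof.
split=> [fW n n_gt0|fP n n_gt0].
  have [g fK gK] := fW n n_gt0; split=> [y yn|x x' xn xn' fxx'].
    exists (sval (g (exist _ y yn))); first exact: svalP (g _).
    by have /(congr1 (@sval _ _)) := gK (exist _ y yn).
  suff /(congr1 (@sval _ _)) : (exist _ x xn : cyc n S) = exist _ x' xn' by [].
  by apply: (can_inj fK); apply: sval_inj.
have [f_surj f_inj] := fP n n_gt0.
have gP (y : cyc n T) : {x : cyc n S | cyc_map f x = y}.
  apply: cid; case: y => y yn; have [x xn fx] := f_surj y yn.
  by exists (exist (fun z => iter n sigma z = z) x xn); apply: sval_inj.
exists (fun y => sval (gP y)) => [x|y]; last exact: svalP (gP y).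
have /(congr1 (@sval _ _)) /= := svalP (gP (cyc_map f x)).
move=> fgx; apply: sval_inj.
exact: f_inj (svalP (sval (gP (cyc_map f x)))) (svalP x) fgx.
Qed.

Definition periodic (S : zset) (x : S) : Prop :=
  exists2 n, 0 < n & iter n sigma x = x.

Lemma periodic_sigma (S : zset) (x : S) : periodic (sigma x) <-> periodic x.
Proof.
split=> -[n n_gt0 xn]; exists n => //; last by rewrite -iterSr iterS xn.
by apply: sigma_inj; rewrite -iterS iterSr.
Qed.

Lemma periodic_zfun (S T : zset) (f : zmap S T) (x : S) :
  periodic x -> periodic (f x).
Proof. by move=> [n n_gt0 /(zfun_iter f)]; exists n. Qed.

Lemma iter_period_mul (S : zset) (m n : nat) (x : S) :
  iter n sigma x = x -> iter (m * n) sigma x = x.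
Proof. by move=> xn; elim: m => //= m IH; rewrite mulSn iterD IH. Qed.

(** Points fixed by [iter m sigma] and [iter n sigma] are both fixed by [iter (m * n) sigma], and
    [f] is injective on such points. *)
Lemma acyclic_inj (S T : zset) (f : zmap S T) (x y : S) : acyclic f ->
  periodic x -> periodic y -> f x = f y -> x = y.
Proof.
move=> /acyclicP fW [m m_gt0 xm] [n n_gt0 yn].
have mn_gt0 : 0 < m * n by rewrite muln_gt0 m_gt0.
apply: (fW _ mn_gt0).2; last exact: iter_period_mul.
by rewrite mulnC; apply: iter_period_mul.
Qed.

Lemma acyclic_surj (S T : zset) (f : zmap S T) (y : T) : acyclic f ->
  periodic y -> exists2 x, periodic x & f x = y.
Proof.
move=> /acyclicP fW [n n_gt0 yn].
by have [x xn fx] := (fW n n_gt0).1 y yn; exists x => //; exists n.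
Qed.

(** [cyc_map] respects composition, and bijections can be cancelled from either side of a
    composite. *)
Lemma acyclic_two_of_three : two_of_three acyclic.
Proof.
move=> X Y Z b a.
have abE n : @cyc_map n _ _ (a \c b) =1 cyc_map a \o cyc_map b.
  by move=> x; apply: sval_inj.
split; [|split] => aW bW n n_gt0.
- apply: (eq_bij (bij_comp (aW n n_gt0) (bW n n_gt0))).
  by move=> x; rewrite abE.
- have [g aK gK] := aW n n_gt0.
  by apply: (eq_bij (bij_comp (Bijective gK aK) (bW n n_gt0))) => x; rewrite /= abE aK.
- have [g bK gK] := aW n n_gt0.
  by apply: (eq_bij (bij_comp (bW n n_gt0) (Bijective gK bK))) => x; rewrite /= abE /= gK.
Qed.

Lemma acyclic_iso (X Y : ZSet) (f : hom X Y) : isomorphism X Y f -> acyclic f.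
Proof.
move=> [g [gf fg]] n n_gt0; exists (cyc_map g) => x; apply: sval_inj.
  exact: zmap_eqfun gf (sval x).
exact: zmap_eqfun fg (sval x).
Qed.

(** [f] is a retract of [g] over [Y]: [h] carries preimages under [g] to preimages under [f], and
    the split map [s] transfers injectivity from [g]. *)
Lemma acyclic_retract (X Y Z : ZSet) (f : hom X Y) (g : hom Z Y)
    (s : hom X Z) (h : hom Z X) :
  acyclic g -> h \c s = idm X -> g \c s = f -> f \c h = g -> acyclic f.
Proof.
move=> /acyclicP gW hs gs fh; apply/acyclicP => n n_gt0.
have [g_surj g_inj] := gW n n_gt0; split=> [y yn|x x' xn xn' fxx'].
  have [z zn gz] := g_surj y yn; exists (h z); first exact: zfun_iter.
  by rewrite -gz -fh.
suff sxx' : s x = s x'.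
  by rewrite -[x](zmap_eqfun hs) -[x'](zmap_eqfun hs) /= sxx'.
apply: g_inj; try exact: zfun_iter.
by move: fxx'; rewrite -gs.
Qed.

(** * The factorization through non-periodic points of [X] and periodic points of [Y] *)

Section PeriodicFactorization.
Variables (X Y : zset) (f : zmap X Y).

Lemma nonperiodic_sigma (x : X) : ~ periodic (sigma x) <-> ~ periodic x.
Proof. by rewrite periodic_sigma. Qed.

Definition periodic_part : zset := zsub (@periodic_sigma Y).

Definition nonperiodic_part : zset := zsub nonperiodic_sigma.

Definition periodic_mid : zset := zsum nonperiodic_part periodic_part.

Definition mid_left_fun (x : X) : periodic_mid :=
  match pselect (periodic x) with
  | left px => inr (exist _ (f x) (periodic_zfun f px))
  | right npx => inl (exist _ x npx)
  end.

Lemma mid_left_funP (x : X) (px : periodic x) :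
  mid_left_fun x = inr (exist _ (f x) (periodic_zfun f px)).
Proof.
by rewrite /mid_left_fun; case: pselect => // px'; congr inr; apply: sval_inj.
Qed.

Lemma mid_left_funN (x : X) (npx : ~ periodic x) :
  mid_left_fun x = inl (exist _ x npx).
Proof.
by rewrite /mid_left_fun; case: pselect => // px'; congr inl; apply: sval_inj.
Qed.

Lemma mid_left_sigma (x : X) : mid_left_fun (sigma x) = sigma (mid_left_fun x).
Proof.
case: (pselect (periodic x)) => [px|npx].
  rewrite (mid_left_funP px) (mid_left_funP ((periodic_sigma x).2 px)) /=.
  by congr inr; apply: sval_inj; rewrite /= zfun_sigma.
rewrite (mid_left_funN npx) (mid_left_funN ((nonperiodic_sigma x).2 npx)) /=.
by congr inl; apply: sval_inj.
Qed.

Definition mid_left : zmap X periodic_mid := ZMap mid_left_sigma.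

Definition mid_right : zmap periodic_mid Y :=
  zsum_case (zcomp f (zsub_incl nonperiodic_sigma))
            (zsub_incl (@periodic_sigma Y)).

Lemma mid_right_left : zcomp mid_right mid_left = f.
Proof.
apply: zmap_ext => x /=; case: (pselect (periodic x)) => [px|npx].
  by rewrite (mid_left_funP px).
by rewrite (mid_left_funN npx).
Qed.

(** A point of the left summand fixed by a positive iterate would be a periodic point of [X], which
    that summand excludes. *)
Lemma periodic_mid_inr (n : nat) (z : periodic_mid) : 0 < n ->
  iter n sigma z = z -> exists y, z = inr y.
Proof.
case: z => [x n_gt0|y _ _]; last by exists y.
rewrite iter_zsum_inl => -[/(congr1 (@sval _ _))]; rewrite iter_zsub_sigma => xn.
by case: (svalP x); exists n.
Qed.

Lemma acyclic_mid_right : acyclic mid_right.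
Proof.
apply/acyclicP => n n_gt0; split=> [y yn|z z' zn zn'].
  have py : periodic y by exists n.
  exists (inr (exist _ y py)) => //.
  by rewrite iter_zsum_inr; congr inr; apply: sval_inj; rewrite iter_zsub_sigma.
have [y ->] := periodic_mid_inr n_gt0 zn.
have [y' ->] := periodic_mid_inr n_gt0 zn'.
by move=> /= yy'; congr inr; apply: sval_inj.
Qed.

Lemma llp_mid_left : @llp ZSet acyclic X periodic_mid mid_left.
Proof.
move=> A B g gW u v guv.
(* On the right summand the filler must take the periodic preimage under [g]; it exists because [g]
   is acyclic. *)
have kP (y : periodic_part) : {a : A | periodic a /\ g a = v (inr y)}.
  apply: cid; have [//|a pa ga] := acyclic_surj (y := v (inr y)) gW.
    apply: (periodic_zfun (zcomp v (zsum_inr _ _))).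
    have [n n_gt0 yn] := svalP y; exists n => //.
    by apply: sval_inj; rewrite iter_zsub_sigma.
  by exists a.
(* Equivariance follows from uniqueness: both sides are periodic with the same image under [g]. *)
have k_sigma y : sval (kP (sigma y)) = sigma (sval (kP y)).
  have [[psy gsy] [py gy]] := (svalP (kP (sigma y)), svalP (kP y)).
  apply: (acyclic_inj gW) => //; first exact/periodic_sigma.
  by rewrite gsy [RHS]zfun_sigma gy -zfun_sigma.
exists (zsum_case (zcomp u (zsub_incl nonperiodic_sigma)) (ZMap k_sigma)).
split; apply: zmap_ext; [move=> x | move=> [x|y]] => /=.
- case: (pselect (periodic x)) => [px|npx]; last by rewrite (mid_left_funN npx).
  rewrite (mid_left_funP px); case: (svalP (kP (exist _ _ (periodic_zfun f px)))).
  (* The same uniqueness applies to [u x], which is periodic since [x] is. *)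
  move=> pk gk; apply: (acyclic_inj gW) => //; first exact: periodic_zfun.
  by rewrite gk -mid_left_funP; apply/esym/(zmap_eqfun guv).
(* A point of the left summand is the image of itself under [mid_left], so commutativity of the
   given square suffices. *)
- rewrite [LHS](zmap_eqfun guv) /= (mid_left_funN (svalP x)).
  by congr (v (inl _)); apply: sval_inj.
- by case: (svalP (kP y)).
Qed.

End PeriodicFactorization.

(** * The two weak factorization systems and the model structure *)

Lemma llp_acyclic_wfs : weak_factorization_system (llp acyclic) acyclic.
Proof.
split=> //.
  apply: mor_class_ext => X Y f; split=> [f_rlp|fW A B l]; last exact.
  (* A filler of this square, with [mid_left f] on the left and [f] on the right, exhibits [f] as a
     retract of [mid_right f]. *)
  have fE : f \c idm X = (mid_right f : hom (periodic_mid X Y : ZSet) Y) \c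
      mid_left f by rewrite comp_idr; apply/esym/mid_right_left.
  have [h [hl fh]] := f_rlp _ _ _ (@llp_mid_left X Y f) _ _ fE.
  exact: acyclic_retract (acyclic_mid_right f) hl (mid_right_left f) fh.
move=> X Y f; exists (periodic_mid X Y), (mid_left f), (mid_right f).
split; first exact: llp_mid_left.
by split; [exact: acyclic_mid_right | exact/esym/mid_right_left].
Qed.

Lemma llp_acyclic_cap : mor_cap (llp acyclic) acyclic = @isomorphism ZSet.
Proof.
apply: mor_class_ext => X Y f; split=> [[fl fW]|f_iso].
  exact/lifts_self_iso/fl.
by split; [move=> A B g _; apply: iso_lifts | apply: acyclic_iso].
Qed.

Theorem mainTheorem7 :
  exists M : model_structure ZSet,
    weak_equivalence M = acyclic /\
    fibration M = mor_all /\
    cofibration M = llp (mor_cap (weak_equivalence M) (fibration M)) /\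
    cofibration M = llp (weak_equivalence M).
Proof.
have wfs1 : weak_factorization_system
    (mor_cap (llp acyclic) acyclic) (@mor_all ZSet).
  by rewrite llp_acyclic_cap; apply: isomorphism_all_wfs.
have wfs2 : weak_factorization_system
    (llp acyclic) (mor_cap acyclic (@mor_all ZSet)).
  by rewrite mor_cap_allr; apply: llp_acyclic_wfs.
exists (ModelStructure ZSet_finite_limits ZSet_finite_colimits
  acyclic_two_of_three wfs1 wfs2) => /=.
by rewrite mor_cap_allr.
Qed.
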